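(* Any 2-dimensional real abstract hyporeductive triple algebra (h.t.a.) is isomorphic to one of the h.t.a. of the following types, where $\{u,v\}$ denotes a basis of the algebra and $a,b,c,d,e,f,k$ are real numbers: (I) $u*v=0$, $u\cdot v=0$, $\langle u;u,v\rangle = eu+fv$, $\langle v;u,v\rangle = ku-ev$; (II) $u*v=0$, $u\cdot v=au$, $\langle u;u,v\rangle = 0$, $\langle v;u,v\rangle = ku$ (with $a\neq 0$); (III) $u*v=0$, $u\cdot v=au+bv$, $\langle u;u,v\rangle = 0$, $\langle v;u,v\rangle = 0$ (with $a\neq 0$, $b\neq 0$); (IV) $u*v=0$, $u\cdot v=au+bv$, $\langle u;u,v\rangle = eu+fv$, $\langle v;u,v\rangle = ku-ev$ (with $a\neq 0$, $b\neq 0$, $e\neq 0$, $f\neq 0$, $k\neq -e$, $af-be=0=bk+ae$); (V) $u*v=cu+dv$, $u\cdot v=0$, $\langle u;u,v\rangle = eu+fv$, $\langle v;u,v\rangle = ku-ev$ (with $(c,d)\neq(0,0)$); (VI) $u*v=cu+dv$, $u\cdot v=au$, $\langle u;u,v\rangle = 0$, $\langle v;u,v\rangle = ku$ (with $a\neq 0$, $(c,d)\neq(0,0)$); (VII) $u*v=cu+dv$, $u\cdot v=au+bv$, $\langle u;u,v\rangle = eu+fv$, $\langle v;u,v\rangle = ku-ev$ (with $a\neq 0$, $b\neq 0$, $e\neq 0$, $f\neq 0$, $k\neq 0$, $(c,d)\neq(0,0)$, $af-be=0=bk+ae$); (VIII) $u*v=cu+dv$, $u\cdot v=au+bv$, $\langle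 u;u,v\rangle = 0$, $\langle v;u,v\rangle = 0$ (with $a\neq 0$, $b\neq 0$, $(c,d)\neq(0,0)$).
   Context: An abstract hyporeductive triple algebra (h.t.a.) is a finite-dimensional linear space $\mathcal V$ (here over $\mathbb R$) with two bilinear skew-symmetric binary operations $\cdot$ and $*$ and one trilinear ternary operation $\langle\,;\,,\,\rangle$ that is skew-symmetric in its last two variables, such that for all $\xi,\eta,\zeta,\kappa,\chi,\theta,\lambda,\mu\in\mathcal V$ the following identities hold, where $\sigma$ denotes the sum over cyclic permutations of $\xi,\eta,\zeta$ and $\Sigma$ denotes the sum over cyclic permutations of the three pairs $(\xi,\eta),(\zeta,\kappa),(\lambda,\mu)$: 1. $\sigma\{\xi\cdot(\eta\cdot\zeta)-\langle\xi;\eta,\zeta\rangle\}=0$; 2. $\sigma\{\zeta*(\xi\cdot\eta)\}=0$; 3. $\sigma\{\langle\theta;\zeta,\xi\cdot\eta\rangle\}=0$; 4. $\kappa\cdot\langle\zeta;\xi,\eta\rangle-\zeta\cdot\langle\kappa;\xi,\eta\rangle+\langle\zeta\cdot\kappa;\xi,\eta\rangle=\langle\xi*\eta;\zeta,\kappa\rangle-\langle\zeta*\kappa;\xi,\eta\rangle+\zeta*\langle\kappa;\xi,\eta\rangle-\kappa*\langle\zeta;\xi,\eta\rangle+(\xi*\eta)*(\zeta*\kappa)+(\xi*\eta)\cdot(\zeta*\kappa)$; 5. $\chi\cdot(\kappa\cdot\langle\zeta;\xi,\eta\rangle-\zeta\cdot\langle\kappa;\xi,\eta\rangle+\langle\zeta\cdot\kappa;\xi,\eta\rangle)+\langle\langle\chi;\xi,\eta\rangle;\zeta,\kappa\rangle-\langle\langle\chi;\zeta,\kappa\rangle;\xi,\eta\rangle+\langle\chi;\zeta,\langle\kappa;\xi,\eta\rangle\rangle-\langle\chi;\kappa,\langle\zeta;\xi,\eta\rangle\rangle=0$;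 6. $\chi*(\kappa\cdot\langle\zeta;\xi,\eta\rangle-\zeta\cdot\langle\kappa;\xi,\eta\rangle+\langle\zeta\cdot\kappa;\xi,\eta\rangle)=0$; 7. $\langle\theta;\chi,\ \kappa\cdot\langle\zeta;\xi,\eta\rangle-\zeta\cdot\langle\kappa;\xi,\eta\rangle+\langle\zeta\cdot\kappa;\xi,\eta\rangle\rangle=0$; 8. $\kappa\cdot\langle\zeta;\xi,\eta\rangle-\zeta\cdot\langle\kappa;\xi,\eta\rangle+\langle\zeta\cdot\kappa;\xi,\eta\rangle+\eta\cdot\langle\xi;\zeta,\kappa\rangle-\xi\cdot\langle\eta;\zeta,\kappa\rangle+\langle\xi\cdot\eta;\zeta,\kappa\rangle=0$; 9. $\zeta*\langle\kappa;\xi,\eta\rangle-\kappa*\langle\zeta;\xi,\eta\rangle+\xi*\langle\eta;\zeta,\kappa\rangle-\eta*\langle\xi;\zeta,\kappa\rangle=0$; 10. $\Sigma\{\langle(\langle\xi\cdot\eta;\zeta,\kappa\rangle+\eta\cdot\langle\xi;\zeta,\kappa\rangle-\xi\cdot\langle\eta;\zeta,\kappa\rangle);\lambda,\mu\rangle+\langle\lambda\cdot\mu;\langle\eta;\zeta,\kappa\rangle,\xi\rangle+\mu\cdot\langle\lambda;\langle\eta;\zeta,\kappa\rangle,\xi\rangle-\lambda\cdot\langle\mu;\langle\eta;\zeta,\kappa\rangle,\xi\rangle-(\langle\lambda\cdot\mu;\langle\xi;\zeta,\kappa\rangle,\eta\rangle+\mu\cdot\langle\lambda;\langle\xi;\zeta,\kappa\rangle,\eta\rangle-\lambda\cdot\langle\mu;\langle\xi;\zeta,\kappa\rangle,\eta\rangle)\}=0$;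 11. $\Sigma\{(\langle\mu;\langle\eta;\zeta,\kappa\rangle,\xi\rangle-\langle\mu;\langle\xi;\zeta,\kappa\rangle,\eta\rangle)*\lambda+(\langle\lambda;\langle\xi;\zeta,\kappa\rangle,\eta\rangle-\langle\lambda;\langle\eta;\zeta,\kappa\rangle,\xi\rangle)*\mu\}=0$; 12. $\Sigma\{\langle\theta;(\langle\mu;\langle\eta;\zeta,\kappa\rangle,\xi\rangle-\langle\mu;\langle\xi;\zeta,\kappa\rangle,\eta\rangle),\lambda\rangle+\langle\theta;(\langle\lambda;\langle\xi;\zeta,\kappa\rangle,\eta\rangle-\langle\lambda;\langle\eta;\zeta,\kappa\rangle,\xi\rangle),\mu\rangle\}=0$. An isomorphism of h.t.a. is a linear bijection preserving all three operations. In dimension 2 with basis $\{u,v\}$, the operations are determined by $u*v$, $u\cdot v$, $\langle u;u,v\rangle$, $\langle v;u,v\rangle$ through (multi)linearity and skew-symmetry. *)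

(* Defs.v *)
From HB Require Import structures.
From mathcomp Require Import all_boot all_order all_algebra.
From mathcomp Require Import reals.
Set Implicit Arguments.
Unset Strict Implicit.
Unset Printing Implicit Defensive.
Import Order.TTheory GRing.Theory Num.Theory.
Local Open Scope ring_scope.

Section CyclicSums.
Variable V : zmodType.

Definition cyc3 (F : V -> V -> V -> V) (x y z : V) : V :=
  F x y z + F y z x + F z x y.

(* The three pairs (x, y), (z, t), (l, m) are permuted cyclically as blocks. *)
Definition cyc3pairs (F : V -> V -> V -> V -> V -> V -> V)
    (x y z t l m : V) : V :=
  F x y z t l m + F z t l m x y + F l m x y z t.

End CyclicSums.

Section HtaIdentities.
Variables (R : realType) (V : vectType R).
Variables (dot star : V -> V -> V) (tri : V -> V -> V -> V).

Local Notation "x ⋅ y" := (dot x y) (at level 40, left associativity).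
Local Notation "x ∗ y" := (star x y) (at level 40, left associativity).
Local Notation "⟨ x ; y , z ⟩" := (tri x y z)
  (at level 0, x at level 99, y at level 99, z at level 99).

Record is_hta : Prop := IsHta {
  dot_linl : forall y, linear (dot^~ y);
  dot_linr : forall x, linear (dot x);
  dot_skew : forall x y, x ⋅ y = - (y ⋅ x);
  star_linl : forall y, linear (star^~ y);
  star_linr : forall x, linear (star x);
  star_skew : forall x y, x ∗ y = - (y ∗ x);
  tri_lin1 : forall y z, linear (fun x => ⟨x; y, z⟩);
  tri_lin2 : forall x z, linear (fun y => ⟨x; y, z⟩);
  tri_lin3 : forall x y, linear (fun z => ⟨x; y, z⟩);
  tri_skew : forall x y z, ⟨x; y, z⟩ = - ⟨x; z, y⟩;
  hta_id1 : forall xi eta zeta,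
    cyc3 (fun xi eta zeta => xi ⋅ (eta ⋅ zeta) - ⟨xi; eta, zeta⟩)
      xi eta zeta = 0;
  hta_id2 : forall xi eta zeta,
    cyc3 (fun xi eta zeta => zeta ∗ (xi ⋅ eta)) xi eta zeta = 0;
  hta_id3 : forall theta xi eta zeta,
    cyc3 (fun xi eta zeta => ⟨theta; zeta, xi ⋅ eta⟩) xi eta zeta = 0;
  hta_id4 : forall xi eta zeta kappa,
    kappa ⋅ ⟨zeta; xi, eta⟩ - zeta ⋅ ⟨kappa; xi, eta⟩
      + ⟨zeta ⋅ kappa; xi, eta⟩
    = ⟨xi ∗ eta; zeta, kappa⟩ - ⟨zeta ∗ kappa; xi, eta⟩
      + zeta ∗ ⟨kappa; xi, eta⟩ - kappa ∗ ⟨zeta; xi, eta⟩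
      + (xi ∗ eta) ∗ (zeta ∗ kappa) + (xi ∗ eta) ⋅ (zeta ∗ kappa);
  hta_id5 : forall chi xi eta zeta kappa,
    chi ⋅ (kappa ⋅ ⟨zeta; xi, eta⟩ - zeta ⋅ ⟨kappa; xi, eta⟩
           + ⟨zeta ⋅ kappa; xi, eta⟩)
    + ⟨⟨chi; xi, eta⟩; zeta, kappa⟩ - ⟨⟨chi; zeta, kappa⟩; xi, eta⟩
    + ⟨chi; zeta, ⟨kappa; xi, eta⟩⟩ - ⟨chi; kappa, ⟨zeta; xi, eta⟩⟩ = 0;
  hta_id6 : forall chi xi eta zeta kappa,
    chi ∗ (kappa ⋅ ⟨zeta; xi, eta⟩ - zeta ⋅ ⟨kappa; xi, eta⟩
           + ⟨zeta ⋅ kappa; xi, eta⟩) = 0;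
  hta_id7 : forall theta chi xi eta zeta kappa,
    ⟨theta; chi, kappa ⋅ ⟨zeta; xi, eta⟩ - zeta ⋅ ⟨kappa; xi, eta⟩
                 + ⟨zeta ⋅ kappa; xi, eta⟩⟩ = 0;
  hta_id8 : forall xi eta zeta kappa,
    kappa ⋅ ⟨zeta; xi, eta⟩ - zeta ⋅ ⟨kappa; xi, eta⟩
    + ⟨zeta ⋅ kappa; xi, eta⟩
    + eta ⋅ ⟨xi; zeta, kappa⟩ - xi ⋅ ⟨eta; zeta, kappa⟩
    + ⟨xi ⋅ eta; zeta, kappa⟩ = 0;
  hta_id9 : forall xi eta zeta kappa,
    zeta ∗ ⟨kappa; xi, eta⟩ - kappa ∗ ⟨zeta; xi, eta⟩
    + xi ∗ ⟨eta; zeta, kappa⟩ - eta ∗ ⟨xi; zeta, kappa⟩ = 0;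
  hta_id10 : forall xi eta zeta kappa lambda mu,
    cyc3pairs (fun xi eta zeta kappa lambda mu =>
      ⟨⟨xi ⋅ eta; zeta, kappa⟩ + eta ⋅ ⟨xi; zeta, kappa⟩
         - xi ⋅ ⟨eta; zeta, kappa⟩; lambda, mu⟩
      + ⟨lambda ⋅ mu; ⟨eta; zeta, kappa⟩, xi⟩
      + mu ⋅ ⟨lambda; ⟨eta; zeta, kappa⟩, xi⟩
      - lambda ⋅ ⟨mu; ⟨eta; zeta, kappa⟩, xi⟩
      - (⟨lambda ⋅ mu; ⟨xi; zeta, kappa⟩, eta⟩
         + mu ⋅ ⟨lambda; ⟨xi; zeta, kappa⟩, eta⟩
         - lambda ⋅ ⟨mu; ⟨xi; zeta, kappa⟩, eta⟩))
      xi eta zeta kappa lambda mu = 0;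
  hta_id11 : forall xi eta zeta kappa lambda mu,
    cyc3pairs (fun xi eta zeta kappa lambda mu =>
      (⟨mu; ⟨eta; zeta, kappa⟩, xi⟩ - ⟨mu; ⟨xi; zeta, kappa⟩, eta⟩) ∗ lambda
      + (⟨lambda; ⟨xi; zeta, kappa⟩, eta⟩
         - ⟨lambda; ⟨eta; zeta, kappa⟩, xi⟩) ∗ mu)
      xi eta zeta kappa lambda mu = 0;
  hta_id12 : forall theta xi eta zeta kappa lambda mu,
    cyc3pairs (fun xi eta zeta kappa lambda mu =>
      ⟨theta; ⟨mu; ⟨eta; zeta, kappa⟩, xi⟩
              - ⟨mu; ⟨xi; zeta, kappa⟩, eta⟩, lambda⟩
      + ⟨theta; ⟨lambda; ⟨xi; zeta, kappa⟩, eta⟩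
                - ⟨lambda; ⟨eta; zeta, kappa⟩, xi⟩, mu⟩)
      xi eta zeta kappa lambda mu = 0
}.

End HtaIdentities.

Record hta (R : realType) := Hta {
  hta_space :> vectType R;
  hdot : hta_space -> hta_space -> hta_space;
  hstar : hta_space -> hta_space -> hta_space;
  htri : hta_space -> hta_space -> hta_space -> hta_space;
  htaP : is_hta hdot hstar htri
}.

Definition hta_isomorphic (R : realType) (A B : hta R) : Prop :=
  exists f : {linear A -> B},
    [/\ bijective f,
        forall x y, f (hdot x y) = hdot (f x) (f y),
        forall x y, f (hstar x y) = hstar (f x) (f y)
      & forall x y z, f (htri x y z) = htri (f x) (f y) (f z)].

Section Types.
Variables (R : realType) (A : hta R).

(* {u, v} is a basis in which u * v = s, u . v = p, <u; u, v> = q and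
   <v; u, v> = r; by skew-symmetry this determines all three operations. *)
Definition hta_table (u v s p q r : A) : Prop :=
  basis_of {:A} [:: u; v] /\
  [/\ hstar u v = s, hdot u v = p, htri u u v = q & htri v u v = r].

Definition hta_typeI : Prop :=
  exists (u v : A) (e f k : R),
    hta_table u v 0 0 (e *: u + f *: v) (k *: u - e *: v).

Definition hta_typeII : Prop :=
  exists (u v : A) (a k : R),
    hta_table u v 0 (a *: u) 0 (k *: u) /\ a != 0.

Definition hta_typeIII : Prop :=
  exists (u v : A) (a b : R),
    hta_table u v 0 (a *: u + b *: v) 0 0 /\ (a != 0 /\ b != 0).

Definition hta_typeIV : Prop :=
  exists (u v : A) (a b e f k : R),
    [/\ hta_table u v 0 (a *: u + b *: v)
          (e *: u + f *: v) (k *: u - e *: v),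
        [/\ a != 0, b != 0, e != 0, f != 0 & k != - e],
        a * f - b * e = 0
      & b * k + a * e = 0].

Definition hta_typeV : Prop :=
  exists (u v : A) (c d e f k : R),
    hta_table u v (c *: u + d *: v) 0
      (e *: u + f *: v) (k *: u - e *: v) /\ (c, d) != (0, 0).

Definition hta_typeVI : Prop :=
  exists (u v : A) (a c d k : R),
    [/\ hta_table u v (c *: u + d *: v) (a *: u) 0 (k *: u),
        a != 0 & (c, d) != (0, 0)].

Definition hta_typeVII : Prop :=
  exists (u v : A) (a b c d e f k : R),
    [/\ hta_table u v (c *: u + d *: v) (a *: u + b *: v)
          (e *: u + f *: v) (k *: u - e *: v),
        [/\ a != 0, b != 0, e != 0, f != 0 & k != 0],
        (c, d) != (0, 0),
        a * f - b * e = 0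
      & b * k + a * e = 0].

Definition hta_typeVIII : Prop :=
  exists (u v : A) (a b c d : R),
    [/\ hta_table u v (c *: u + d *: v) (a *: u + b *: v) 0 0,
        a != 0, b != 0 & (c, d) != (0, 0)].

End Types.

(* Main.v *)
Require Import Defs.
From mathcomp Require Import all_boot all_order all_algebra.
From mathcomp Require Import reals.
Local Open Scope ring_scope.
Set Implicit Arguments.
Unset Strict Implicit.
Import GRing.Theory Num.Theory.

(** No change of algebra is needed: the proof takes B = A and looks for a good
    basis.  For a basis u, v put p = u.v and let D be the operator
    x |-> <x; u, v>.  Since every skew form on a plane is a multiple of the
    determinant, the expression
      v.<u; u, v> - u.<v; u, v> + <u.v; u, v>,
    which recurs in the identities, equals D p - tr(D) p.  Identity 8 with both
    pairs equal to (u, v) says that twice this vector vanishes, so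
    D p = tr(D) p; identity 5 then reduces to tr(D) D = 0.  Taking the trace
    gives tr(D) = 0, hence D p = 0 ([hta_tri_traceless]).

    If p = 0, any basis gives type I or V, according to whether u*v vanishes.
    If p <> 0, all values of the dot product lie on the line of p, so p can be
    completed to a basis p, w with p.w = a p and a <> 0 ([hta_dot_basis]).  In
    this basis the new operator D is traceless and kills p, so it maps w to a
    multiple of p: this is type II or VI.  Thus types III, IV, VII and VIII
    are, up to the choice of basis, instances of II and VI. *)

Lemma add_self_eq0 (R : realType) (V : lmodType R) (x : V) : x + x = 0 -> x = 0.
Proof.
move=> /eqP; rewrite -mulr2n -scaler_nat scaler_eq0 pnatr_eq0 /=.
exact: eqP.
Qed.

Lemma linear_at0 (R : realType) (V W : lmodType R) (f : V -> W) :
  linear f -> f 0 = 0.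
Proof. by move=> lf; have := scalable_linear lf 0 0; rewrite /= !scale0r. Qed.

Lemma linear_comb2 (R : realType) (V W : lmodType R) (f : V -> W) :
  linear f ->
  forall (a b : R) (x y : V), f (a *: x + b *: y) = a *: f x + b *: f y.
Proof. by move=> lf a b x y; rewrite lf (scalable_linear lf). Qed.

Section SkewBilinear.
Variables (R : realType) (V W : lmodType R) (g : V -> V -> W).
Hypothesis gr : forall x, linear (g x).
Hypothesis gskew : forall x y, g x y = - g y x.

Lemma skew_diag x : g x x = 0.
Proof. by apply: add_self_eq0; rewrite {1}gskew addNr. Qed.

Lemma skew_combr (a b : R) (u v : V) : g u (a *: u + b *: v) = b *: g u v.
Proof. by rewrite (linear_comb2 (gr u)) (skew_diag u) scaler0 add0r. Qed.

Lemma skew_combl (a b : R) (u v : V) : g v (a *: u + b *: v) = - (a *: g u v).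
Proof.
by rewrite (linear_comb2 (gr v)) (skew_diag v) scaler0 addr0 gskew scalerN.
Qed.

End SkewBilinear.

Section PairBasis.
Variables (R : realType) (V : vectType R).

Lemma basis2_coords (u v : V) : basis_of {:V} [:: u; v] ->
  forall x, exists a b : R, x = a *: u + b *: v.
Proof.
move=> buv x; have := memvf x; rewrite -(span_basis buv) span_cons span_seq1.
by case/memv_addP=> _ /vlineP[a ->] [_ /vlineP[b ->] ->]; exists a, b.
Qed.

Lemma basis2_coord_eq0 (u v : V) (a b : R) : basis_of {:V} [:: u; v] ->
  a *: u + b *: v = 0 -> a = 0 /\ b = 0.
Proof.
move=> buv uv0; have /freeP/(_ (fun i : 'I_2 => [:: a; b]`_i)) := basis_free buv.
rewrite !big_ord_recl big_ord0 /= addr0 => /(_ uv0) ab0.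
by split; [exact: (ab0 ord0) | exact: (ab0 (lift ord0 ord0))].
Qed.

Lemma dim2_basis : \dim {:V} = 2%N -> exists u v : V, basis_of {:V} [:: u; v].
Proof.
move=> dV; have := vbasisP {:V}; have := etrans (size_tuple (vbasis {:V})) dV.
by case: (tval _) => [|u [|v [|]]] // _ buv; exists u, v.
Qed.

(** A skew form vanishes on dependent pairs, so in a plane a nonzero value
    certifies a basis. *)
Lemma skew_neq0_basis (W : lmodType R) (g : V -> V -> W) (u v : V) :
    (forall x, linear (g x)) -> (forall x y, g x y = - g y x) ->
  \dim {:V} = 2%N -> g u v != 0 -> basis_of {:V} [:: u; v].
Proof.
move=> gr gskew dV guv; rewrite basisEfree subvf dV andbT.
rewrite free_cons span_seq1 seq1_free.
apply/andP; split; apply: contraNN guv.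
  case/vlineP=> k ->.
  by rewrite gskew (scalable_linear (gr v)) /= skew_diag // scaler0 oppr0.
by move=> /eqP ->; rewrite (linear_at0 (gr u)).
Qed.

End PairBasis.

Section Dim2.
Variables (R : realType) (A : hta R).
Let H := htaP A.

(** Identity 8 says that <.; u, v> multiplies u.v by the trace of that operator,
    and identity 5 makes the trace vanish. *)
Lemma hta_tri_traceless (u v : A) : basis_of {:A} [:: u; v] ->
  htri (hdot u v) u v = 0 /\
  exists e f k : R,
    htri u u v = e *: u + f *: v /\ htri v u v = k *: u - e *: v.
Proof.
move=> buv.
have [e [f Du]] := basis2_coords buv (htri u u v).
have [k [l Dv]] := basis2_coords buv (htri v u v).
(* By skewness only the diagonal entries e and l of <.; u, v> survive. *)
have trP x : htri x u (htri v u v) - htri x v (htri u u v) = (e + l) *: htri x u v.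
  rewrite Du Dv (skew_combr (tri_lin3 H x) (tri_skew H x)).
  by rewrite (skew_combl (tri_lin3 H x) (tri_skew H x)) opprK scalerDl addrC.
have dotE : hdot v (htri u u v) - hdot u (htri v u v) = - ((e + l) *: hdot u v).
  rewrite Du Dv (skew_combr (dot_linr H) (dot_skew H)).
  by rewrite (skew_combl (dot_linr H) (dot_skew H)) scalerDl opprD.
have E0 : htri (hdot u v) u v = (e + l) *: hdot u v.
  apply/eqP; rewrite -subr_eq0 addrC -dotE; apply/eqP.
  apply: add_self_eq0; rewrite -[RHS](hta_id8 H u v u v).
  by rewrite !addrA.
have D0 x : (e + l) *: htri x u v = 0.
  rewrite -trP -[RHS](hta_id5 H x u v u v) dotE E0 addNr.
  rewrite (linear_at0 (dot_linr H x)) add0r.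
  by rewrite subrr add0r.
have t0 : e + l = 0.
  apply/eqP; apply/negPn/negP => t0.
  have D0' x : htri x u v = 0.
    by apply/eqP; move/eqP: (D0 x); rewrite scaler_eq0 (negPf t0).
  case/negP: t0.
  have [-> _] := basis2_coord_eq0 buv (etrans (esym Du) (D0' u)).
  have [_ ->] := basis2_coord_eq0 buv (etrans (esym Dv) (D0' v)).
  by rewrite addr0.
split; first by rewrite E0 t0 scale0r.
exists e, f, k; split=> //; rewrite Dv -scaleNr; congr (_ + _ *: _).
by apply/eqP; rewrite -addr_eq0 addrC t0.
Qed.

(** With p = u.v = a u + b v one has p.v = a p and p.u = - b p, and one of the
    two coefficients is nonzero. *)
Lemma hta_dot_basis (dimA : \dim {:A} = 2%N) (u v : A) :
    basis_of {:A} [:: u; v] -> hdot u v != 0 ->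
  exists (w : A) (a : R), [/\ basis_of {:A} [:: hdot u v; w],
    hdot (hdot u v) w = a *: hdot u v & a != 0].
Proof.
move=> buv p0; set p := hdot u v in p0 *.
have [a [b pE]] := basis2_coords buv p.
have pu : hdot p u = (- b) *: p.
  by rewrite (dot_skew H) {1}pE (skew_combr (dot_linr H) (dot_skew H)) scaleNr.
have pv : hdot p v = a *: p.
  rewrite (dot_skew H) {1}pE (skew_combl (dot_linr H) (dot_skew H)).
  by rewrite opprK.
have basis_p w : hdot p w != 0 -> basis_of {:A} [:: p; w].
  exact: (skew_neq0_basis (dot_linr H) (dot_skew H) dimA).
have [a0|a0] := eqVneq a 0; last first.
  exists v, a; split=> //.
  by apply: basis_p; rewrite pv scaler_eq0 negb_or a0.
have b0 : - b != 0.
  rewrite oppr_eq0; apply: contraNneq p0 => b0.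
  by rewrite pE a0 b0 !scale0r addr0.
exists u, (- b); split=> //.
by apply: basis_p; rewrite pu scaler_eq0 negb_or b0.
Qed.

Lemma hta_star_coords (u v : A) : basis_of {:A} [:: u; v] -> hstar u v != 0 ->
  exists c d : R, hstar u v = c *: u + d *: v /\ (c, d) != (0, 0).
Proof.
move=> buv s0; have [c [d sE]] := basis2_coords buv (hstar u v).
exists c, d; split=> //; apply: contraNneq s0 => -[c0 d0].
by rewrite sE c0 d0 !scale0r addr0.
Qed.

Lemma hta_dot0_type (u v : A) : basis_of {:A} [:: u; v] -> hdot u v = 0 ->
  hta_typeI A \/ hta_typeV A.
Proof.
move=> buv p0; have [_ [e [f [k [Du Dv]]]]] := hta_tri_traceless buv.
have [s0|s0] := eqVneq (hstar u v) 0; first by left; exists u, v, e, f, k.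
have [c [d [sE cd0]]] := hta_star_coords buv s0.
by right; exists u, v, c, d, e, f, k.
Qed.

(** <u; u, v> = 0 because u is proportional to u.v; the vanishing trace then
    removes the v-component of <v; u, v>. *)
Lemma hta_dot_neq0_type (u v : A) (a : R) : basis_of {:A} [:: u; v] ->
  hdot u v = a *: u -> a != 0 -> hta_typeII A \/ hta_typeVI A.
Proof.
move=> buv pE a0; have [Dp [e [f [k [Du Dv]]]]] := hta_tri_traceless buv.
have Du0 : htri u u v = 0.
  move: Dp; rewrite pE (scalable_linear (tri_lin1 H u v)) => /eqP.
  by rewrite scaler_eq0 (negPf a0) => /eqP.
have [e0 _] := basis2_coord_eq0 buv (etrans (esym Du) Du0).
rewrite e0 scale0r subr0 in Dv.
have [s0|s0] := eqVneq (hstar u v) 0; first by left; exists u, v, a, k.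
have [c [d [sE cd0]]] := hta_star_coords buv s0.
by right; exists u, v, a, c, d, k.
Qed.

End Dim2.

Lemma hta_isomorphic_refl (R : realType) (A : hta R) : hta_isomorphic A A.
Proof. by exists idfun; split=> //; exists id. Qed.

Theorem mainTheorem1 (R : realType) (A : hta R) (dimA : \dim {:A} = 2%N) :
  exists B : hta R, hta_isomorphic A B /\
    (hta_typeI B \/ hta_typeII B \/ hta_typeIII B \/ hta_typeIV B \/
     hta_typeV B \/ hta_typeVI B \/ hta_typeVII B \/ hta_typeVIII B).
Proof.
exists A; split; first exact: hta_isomorphic_refl.
have [u [v buv]] := dim2_basis dimA.
have [p0|p0] := eqVneq (hdot u v) 0.
  by case: (hta_dot0_type buv p0); tauto.
have [w [a [bpw pw a0]]] := hta_dot_basis dimA buv p0.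
by case: (hta_dot_neq0_type bpw pw a0); tauto.
Qed.
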